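(* Let $\alpha\ge0$ and let $f:\mathbb{R}^d\to\mathbb{R}$ be $L$-coordinate-Lipschitz with constants $L_1,\dots,L_d>0$, i.e. for all $i\in[d]$, $x\in\mathbb{R}^d$, $h\in\mathbb{R}$: $|\nabla_i f(x+h\mathbf{e}_i)-\nabla_i f(x)|\le L_i|h|$. Let $f$ be $\mu_{1-\alpha}$-strongly convex with respect to $\|\cdot\|_{[1-\alpha]}$ with $\mu_{1-\alpha}>0$, i.e. for all $x,y\in\mathbb{R}^d$ $$f(y)\ge f(x)+\langle\nabla f(x),y-x\rangle+\frac{\mu_{1-\alpha}}{2}\|y-x\|_{[1-\alpha]}^2 .$$ Let $x^*$ be the minimizer of $f$, and let $x_0,x_1,\dots$ be the iterates of the algorithm OrderRCD (described in the context), run with the Order Oracle with noise level $\Delta$ and with line-search accuracy $\epsilon$. Let $F_0=f(x_0)-f(x^* )$ and $\Phi=\frac{1+\sqrt5}{2}$. Then for every number of iterations $N$ $$\mathbb{E}[f(x_N)]-f(x^* )\le\left(1-\frac{\mu_{1-\alpha}}{S_\alpha}\right)^N F_0+\frac{2S_\alpha\epsilon}{\mu_{1-\alpha}}+\frac{2c\,S_\alpha\Phi\Delta}{\mu_{1-\alpha}},$$ where $c$ is the constant of the line-search guarantee.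
   Context: Notation: $[d]=\{1,\dots,d\}$; $\mathbf{e}_i$ is the $i$-th unit vector of $\mathbb{R}^d$; $\nabla_i f$ is the $i$-th partial derivative of the differentiable function $f$. For real $s$: $S_s=\sum_{i=1}^d L_i^s$ and $\|x\|_{[s]}=\sqrt{\sum_{i=1}^d L_i^s x_i^2}$. Order Oracle: the function $f$ is accessed only through $\phi(x,y)=\mathrm{sign}[f(x)-f(y)+\delta(x,y)]$, where the noise satisfies $|\delta(x,y)|\le\Delta$, $\Delta\ge 0$. Algorithm OrderRCD (random coordinate descent with order oracle): given $x_0\in\mathbb{R}^d$, at each iteration $k=0,1,\dots$: (1) draw, independently of the past, a coordinate $i_k\in[d]$ with probabilities $p_\alpha(i)=L_i^\alpha/S_\alpha$; (2) compute $\eta_k\approx\mathrm{argmin}_{\eta\in\mathbb{R}}f(x_k+\eta\mathbf{e}_{i_k})$ by a line search (the golden ratio method) that uses only the Order Oracle; (3) set $x_{k+1}=x_k+\eta_k\mathbf{e}_{i_k}$. Line-search guarantee (standing convention): the computed $\eta_k$ satisfies $f(x_k+\eta_k\mathbf{e}_{i_k})\le f(x_k+\eta\mathbf{e}_{i_k})+\epsilon+c\,\Phi\,\Delta$ for all $\eta\in\mathbb{R}$, where $\epsilon\ge0$ is the accuracy (in function value) of the line search, $\Phi=\frac{1+\sqrt5}{2}$, and $c\ge 0$ is a constant. $\mathbb{E}$ is the expectation over the random choice of coordinates. *)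

(* Defs.v *)
From HB Require Import structures.
From mathcomp Require Import all_boot all_order all_algebra.
From mathcomp Require Import all_classical all_reals all_analysis.

Set Implicit Arguments.
Unset Strict Implicit.
Unset Printing Implicit Defensive.

Import Order.TTheory GRing.Theory Num.Theory.
Import numFieldNormedType.Exports.

Local Open Scope classical_set_scope.
Local Open Scope ring_scope.

Section Geometry.
Variables (R : realType) (d : nat).
Implicit Types (L : 'I_d -> R) (f : 'rV[R]_d -> R) (x y : 'rV[R]_d).

Definition unit_vec (i : 'I_d) : 'rV[R]_d := delta_mx ord0 i.

Definition partial f (i : 'I_d) x : R := 'D_(unit_vec i) f x.

Definition gradient f x : 'rV[R]_d := \row_i partial f i x.

Definition inner x y : R := \sum_(i < d) x ord0 i * y ord0 i.

Definition S_ L (s : R) : R := \sum_(i < d) L i `^ s.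

Definition wnorm L (s : R) x : R :=
  Num.sqrt (\sum_(i < d) L i `^ s * x ord0 i ^+ 2).

Definition coordinate_lipschitz L f : Prop :=
  forall (i : 'I_d) x (h : R),
    `|partial f i (x + h *: unit_vec i) - partial f i x| <= L i * `|h|.

Definition strongly_convex L (s mu : R) f : Prop :=
  forall x y,
    f x + inner (gradient f x) (y - x) + mu / 2 * wnorm L s (y - x) ^+ 2 <= f y.

Definition minimizer f x : Prop := forall y, f x <= f y.

Definition golden_ratio : R := (1 + Num.sqrt 5) / 2.

End Geometry.

Section Algorithm.
Variables (R : realType) (d : nat).

Definition oracle : Type := 'rV[R]_d -> 'rV[R]_d -> R.

Definition order_oracle (f : 'rV[R]_d -> R) (delta : oracle) : oracle :=
  fun x y => Num.sg (f x - f y + delta x y).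

(* A line-search procedure receives the oracle, the coordinates drawn at the
   earlier iterations, the current point and the current coordinate, and returns
   a step size.  The objective is not an argument: a procedure such as the golden
   ratio method reaches it through the oracle only. *)
Definition line_search : Type :=
  oracle -> seq 'I_d -> 'rV[R]_d -> 'I_d -> R.

Section Run.
Variables (phi : oracle) (search : line_search) (x0 : 'rV[R]_d).
Variable i_ : nat -> 'I_d.

Fixpoint OrderRCD (k : nat) : 'rV[R]_d :=
  if k is k'.+1 then
    let x := OrderRCD k' in
    x + search phi (mkseq i_ k') x (i_ k') *: unit_vec R (i_ k')
  else x0.

Definition OrderRCD_step (k : nat) : R :=
  search phi (mkseq i_ k) (OrderRCD k) (i_ k).

End Run.

(* One inequality per iteration of the run with coordinates [i_]; it constrains
   the search only at the points this run visits. *)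
Definition line_search_guarantee (f : 'rV[R]_d -> R) (phi : oracle)
    (search : line_search) (x0 : 'rV[R]_d) (eps c Delta : R)
    (i_ : nat -> 'I_d) : Prop :=
  forall (k : nat) (eta : R),
    let x := OrderRCD phi search x0 i_ k in
    let e := unit_vec R (i_ k) in
    f (x + OrderRCD_step phi search x0 i_ k *: e)
      <= f (x + eta *: e) + eps + c * golden_ratio R * Delta.

End Algorithm.

Section Sampling.
Variables (R : realType) (d : nat) (disp : measure_display).
Variables (T : measurableType disp) (P : probability T R).
Implicit Type I : nat -> T -> 'I_d.

Definition coordinate_law (L : 'I_d -> R) (alpha : R) (i : 'I_d) : R :=
  L i `^ alpha / S_ L alpha.

Definition independent_of_past I : Prop :=
  forall (k : nat) (i : 'I_d) (h : nat -> 'I_d),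
    let now := [set w | I k w = i] in
    let past := [set w | forall l, (l < k)%N -> I l w = h l] in
    P (now `&` past) = (P now * P past)%E.

Definition random_coordinates (L : 'I_d -> R) (alpha : R) I : Prop :=
  [/\ forall k i, measurable [set w | I k w = i],
      forall k i, P [set w | I k w = i] = (coordinate_law L alpha i)%:E
    & independent_of_past I].

End Sampling.

(* Main.v *)
Require Import Defs.
From mathcomp Require Import all_boot all_order all_algebra.
From mathcomp Require Import all_classical all_reals all_analysis.
From mathcomp Require Import measurable_realfun.
From mathcomp Require Import ring lra.
Import Order.TTheory GRing.Theory Num.Theory.
Import numFieldNormedType.Exports.
Local Open Scope ring_scope.

(** Write [F x = f x - f xstar], [q = mu / S_alpha] and [A = eps + c Phi Delta].
    The claim is the contraction E[F (x_{k+1})] <= (1 - q) E[F (x_k)] + A, iterated.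

    A single step: along a coordinate line [f] lies below the parabola of
    curvature [L_i] tangent to it ([coordinate_descent]), so the best point of
    the line, hence up to [A] the computed point, gains
    (partial_i f)^2 / (2 L_i) ([exact_step_decrease]).  Under the law
    p_i = L_i^alpha / S_alpha the average gain is
    (1 / (2 S_alpha)) sum_i (partial_i f)^2 / L_i^(1 - alpha): the power of
    [L_i] left over is the one for which strong convexity in the norm
    [1 - alpha] bounds the sum below by [2 mu F] ([polyak_lojasiewicz]).
    Together they give [average_decrease].

    Iterating needs [1 - q >= 0].  Comparing the parabolas that enclose [f] on
    a coordinate line gives mu L_i^(1 - alpha) <= L_i, whence mu <= S_alpha
    ([strong_convexity_le_weights]).

    The iterates are functions of the drawn coordinates alone, and for each [k]
    there are finitely many histories of length [k].  Expectations are
    computed by integrating on the events that fix a history: such an event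
    splits according to the next coordinate, with proportions [p_i] by
    independence ([integral_cylinder]).  The line-search guarantee is available only along runs that occur; every
    history met in the recursion has positive probability, so some run realizes
    it ([iterate_rcons_le]).  Induction on the remaining number of draws
    ([forecast_gap_le]) then gives (1 - q)^N F_0 + A sum_{j < N} (1 - q)^j, and
    the geometric sum is at most [1 / q]. *)

(** * Coordinate descent and strong convexity *)

Section CoordinateDescent.
Context {R : realType} {d : nat}.
Implicit Types (f : 'rV[R]_d -> R) (L : 'I_d -> R) (x y v : 'rV[R]_d).

(** The difference quotients of the restriction to a line at [t] are
    literally those of the directional derivative at [x + t *: v]. *)
Lemma is_derive_line f x v (t : R) : differentiable f (x + t *: v) ->
  is_derive t 1 (fun u : R => f (x + u *: v)) ('D_v f (x + t *: v)).
Proof.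
move=> fD.
have E : (fun h : R => h^-1 *: (f (x + (h *: 1 + t) *: v) - f (x + t *: v)))
       = (fun h : R => h^-1 *: (f (h *: v + (x + t *: v)) - f (x + t *: v))).
  by apply: funext => h; rewrite scalerDl addrCA /GRing.scale /= mulr1.
split; last by rewrite /derive E.
by rewrite /derivable E; exact: diff_derivable.
Qed.

(** Up to the constant [f x], the function [r] below is the excess of
    [f (x + t h e_i)] over the parabola.  Its derivative is at most
    [L_i h^2 t - L_i h^2 t = 0] for [t >= 0].  Parametrizing by [t] in [0, 1] treats both signs of [h] at once. *)
Lemma coordinate_descent {L f} : (forall x, differentiable f x) ->
  coordinate_lipschitz L f -> forall x i (h : R),
  f (x + h *: unit_vec R i) <= f x + partial f i x * h + L i / 2 * h ^+ 2.
Proof.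
move=> fD fL x i h.
set v := h *: unit_vec R i; set D := partial f i x.
have Dv t : 'D_v f (x + t *: v) = h * partial f i (x + (t * h) *: unit_vec R i).
  by rewrite /partial !deriveE// -scalerA linearZ.
pose r (t : R) := f (x + t *: v) - (D * h) * t - (L i / 2 * h ^+ 2) * t ^+ 2.
pose r' (t : R) := 'D_v f (x + t *: v) - D * h - L i * h ^+ 2 * t.
have rD (t : R) : is_derive t 1 r (r' t).
  have lineD := is_derive_line f x v t (fD _).
  rewrite /r; apply: is_derive_eq.
  by rewrite /r' /GRing.scale /=; field.
have [t] : exists2 u, u \in `[0, 1] & r 1 - r 0 = r' u * (1 - 0).
  apply: MVT_segment => //.
  apply: derivable_within_continuous => u _; exact: (@ex_derive _ _ _ _ _ _ _ (rD u)).
rewrite in_itv/= => /andP[t0 t1].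
have -> : r 1 - r 0 = f (x + v) - f x - D * h - L i / 2 * h ^+ 2.
  by rewrite /r !scale1r scale0r addr0; field.
suff r'0 : r' t <= 0 by lra.
have := ler_norm ((partial f i (x + (t * h) *: unit_vec R i) - D) * h).
rewrite normrM => /le_trans /(_ (ler_wpM2r (normr_ge0 h) (fL _ _ _))).
rewrite normrM (ger0_norm t0) -!mulrA -expr2 real_normK ?num_real// /r' Dv.
by move=> ?; lra.
Qed.

(** The tangent parabola attains its minimum at eta = - partial_i f / L_i. *)
Lemma exact_step_decrease {L f} : (forall x, differentiable f x) ->
  coordinate_lipschitz L f -> forall x y i (A : R), 0 < L i ->
  (forall eta, f y <= f (x + eta *: unit_vec R i) + A) ->
  f y <= f x - partial f i x ^+ 2 / (2 * L i) + A.
Proof.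
move=> fD fL x y i A Li0 /(_ (- partial f i x / L i)) ymin.
have := coordinate_descent fD fL x i (- partial f i x / L i).
have -> : f x + partial f i x * (- partial f i x / L i)
  + L i / 2 * (- partial f i x / L i) ^+ 2
  = f x - partial f i x ^+ 2 / (2 * L i) by field; lra.
lra.
Qed.

Lemma wnorm_sqr L (s : R) x :
  wnorm L s x ^+ 2 = \sum_i L i `^ s * x ord0 i ^+ 2.
Proof. by rewrite sqr_sqrtr// sumr_ge0// => i _; rewrite mulr_ge0 ?powR_ge0 ?sqr_ge0. Qed.

(** Strong convexity between [0] and [e_i], used in both directions, makes
    [partial_i f] grow by at least [mu L_i^s] along the unit segment, while
    the coordinate Lipschitz condition lets it grow by at most [L_i]. *)
Lemma strong_convexity_le_lipschitz {L s mu f} : strongly_convex L s mu f ->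
  coordinate_lipschitz L f -> forall i, mu * L i `^ s <= L i.
Proof.
move=> fC fL i; set e := unit_vec R i.
have innerE x (h : R) : inner (gradient f x) (h *: e) = h * partial f i x.
  rewrite /inner (bigD1 i)//= big1 ?addr0 => [|j ji].
    by rewrite !mxE !eqxx mulr1 mulrC.
  by rewrite !mxE (negbTE ji) andbF !mulr0.
have wnormE (h : R) : wnorm L s (h *: e) ^+ 2 = L i `^ s * h ^+ 2.
  rewrite wnorm_sqr (bigD1 i)//= big1 ?addr0 => [|j ji].
    by rewrite !mxE !eqxx mulr1.
  by rewrite !mxE (negbTE ji) andbF mulr0 expr0n mulr0.
have := fC 0 e; have := fC e 0; have := fL i 0 1.
have -> : e - 0 = 1 *: e by rewrite scale1r subr0.
have -> : 0 - e = - 1 *: e by rewrite scaleN1r add0r.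
rewrite !innerE !wnormE add0r -/e scale1r normr1.
have := ler_norm (partial f i e - partial f i 0); lra.
Qed.

(** Minimizing the strong convexity lower bound of [f y] over [y] separates
    over coordinates; the i-th minimum is
    [- (partial_i f x)^2 / (2 mu L_i^s)]. *)
Lemma polyak_lojasiewicz {L s mu f} : (forall i, 0 < L i) -> 0 < mu ->
  strongly_convex L s mu f -> forall x y,
  2 * mu * (f x - f y) <= \sum_i partial f i x ^+ 2 / L i `^ s.
Proof.
move=> L0 mu0 fC x y; have := fC x y.
rewrite wnorm_sqr /inner mulr_sumr -addrA -big_split/=.
set z := y - x.
have : \sum_i - (partial f i x ^+ 2 / L i `^ s / (2 * mu)) <=
  \sum_i (gradient f x ord0 i * z ord0 i + mu / 2 * (L i `^ s * z ord0 i ^+ 2)).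
  apply: ler_sum => i _; rewrite mxE; set D := partial _ _ _; set zi := z _ _.
  have a0 := powR_gt0 s (L0 i).
  rewrite -subr_ge0.
  (* Completing the square in the i-th coordinate. *)
  have -> : D * zi + mu / 2 * (L i `^ s * zi ^+ 2)
      - - (D ^+ 2 / L i `^ s / (2 * mu))
    = (mu * L i `^ s * zi + D) ^+ 2 / (2 * mu * L i `^ s) by field; lra.
  by rewrite divr_ge0 ?sqr_ge0// !mulr_ge0 ?ltW.
rewrite sumrN -mulr_suml; set S := \sum_i _; set Z := \sum_i _ => SZ fxy.
have := ler_wpM2l (ltW mu0) (le_trans (lerD (lexx (f x)) SZ) fxy).
have -> : mu * (f x - S / (2 * mu)) = mu * f x - S / 2 by field; lra.
lra.
Qed.

Lemma powR_split {a : R} (alpha : R) : 0 < a ->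
  a = a `^ alpha * a `^ (1 - alpha).
Proof.
move=> a0; rewrite -powRD; last by rewrite (gt_eqF a0) implybT.
by rewrite addrC subrK powRr1// ltW.
Qed.

Lemma sum_weights_gt0 {L} : 'I_d -> (forall i, 0 < L i) ->
  forall s, 0 < S_ L s.
Proof.
move=> i0 L0 s; rewrite /S_ (bigD1 i0)//= ltr_pwDl ?powR_gt0//.
by apply: sumr_ge0 => i _; exact: powR_ge0.
Qed.

Lemma coordinate_law_sum1 {L} : 'I_d -> (forall i, 0 < L i) ->
  forall alpha, \sum_i coordinate_law L alpha i = 1.
Proof.
by move=> i0 L0 a; rewrite -mulr_suml divff// gt_eqF// sum_weights_gt0.
Qed.

(** One coordinate suffices: mu <= L_i^alpha, a single term of S_alpha. *)
Lemma strong_convexity_le_weights {L alpha mu f} : 'I_d ->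
  (forall i, 0 < L i) -> coordinate_lipschitz L f ->
  strongly_convex L (1 - alpha) mu f -> mu <= S_ L alpha.
Proof.
move=> i0 L0 fL fC.
apply: (@le_trans _ _ (L i0 `^ alpha)).
  have := strong_convexity_le_lipschitz fC fL i0.
  rewrite {2}(powR_split alpha (L0 i0)).
  by rewrite ler_pM2r// powR_gt0.
rewrite /S_ (bigD1 i0)//= lerDl.
by apply: sumr_ge0 => i _; exact: powR_ge0.
Qed.

(** The law of the coordinates turns the gain [D_i^2 / (2 L_i)] of each step
    into [D_i^2 / (2 S_alpha L_i^(1 - alpha))], because
    [L_i = L_i^alpha L_i^(1 - alpha)]; this is where the exponents of the
    sampling law and of the norm match. *)
Lemma average_decrease {L alpha mu f} : 'I_d -> (forall i, 0 < L i) ->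
  0 < mu -> (forall x, differentiable f x) -> coordinate_lipschitz L f ->
  strongly_convex L (1 - alpha) mu f ->
  forall x xstar (y : 'I_d -> 'rV[R]_d) (A : R),
  (forall i eta, f (y i) <= f (x + eta *: unit_vec R i) + A) ->
  \sum_i coordinate_law L alpha i * (f (y i) - f xstar)
    <= (1 - mu / S_ L alpha) * (f x - f xstar) + A.
Proof.
move=> i0 L0 mu0 fD fL fC x xstar y A yA.
have S0 := sum_weights_gt0 i0 L0 alpha.
have := polyak_lojasiewicz L0 mu0 fC x xstar; set Q := \sum_i _ => PL.
apply: (@le_trans _ _ (f x - f xstar - Q / (2 * S_ L alpha) + A)).
  have -> : f x - f xstar - Q / (2 * S_ L alpha) + A
      = (f x - f xstar + A) * (\sum_i coordinate_law L alpha i)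
        - Q / (2 * S_ L alpha).
    by rewrite (coordinate_law_sum1 i0 L0 alpha); ring.
  rewrite /Q mulr_sumr mulr_suml -sumrB; apply: ler_sum => i _.
  have := exact_step_decrease fD fL x (y i) i A (L0 i) (yA i).
  rewrite [X in 2 * X](powR_split alpha (L0 i)).
  have a0 := powR_gt0 alpha (L0 i); have b0 := powR_gt0 (1 - alpha) (L0 i).
  rewrite /coordinate_law; set D := partial _ _ _; set a := _ `^ alpha.
  set b := _ `^ (1 - alpha) => yi.
  have -> : (f x - f xstar + A) * (a / S_ L alpha) - D ^+ 2 / b / (2 * S_ L alpha)
    = a / S_ L alpha * (f x - D ^+ 2 / (2 * (a * b)) + A - f xstar).
    by field; rewrite ?gt_eqF.
  by apply: ler_wpM2l; [rewrite divr_ge0 ?ltW | lra].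
rewrite lerD2r -subr_ge0.
have -> : (1 - mu / S_ L alpha) * (f x - f xstar)
    - (f x - f xstar - Q / (2 * S_ L alpha))
  = (Q - 2 * mu * (f x - f xstar)) / (2 * S_ L alpha) by field; rewrite gt_eqF.
by rewrite divr_ge0 ?subr_ge0// mulr_ge0// ltW.
Qed.
End CoordinateDescent.

(** * Expectations over random histories *)

Section RandomCoordinates.
Context {R : realType} {d : nat} (i0 : 'I_d).
Implicit Types (p : 'I_d -> R) (g : seq 'I_d -> R) (s : seq 'I_d).

(** The conditional expectation of [g] of the history after [m] further
    independent draws of law [p], given the history [s]. *)
Fixpoint forecast p g (m : nat) s : R :=
  if m is m'.+1 then \sum_i p i * forecast p g m' (rcons s i) else g s.

Context {disp : measure_display} {T : measurableType disp}.
Context (P : probability T R).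
Implicit Type I : nat -> T -> 'I_d.

Definition cylinder I s : set T :=
  [set w | forall l, (l < size s)%N -> I l w = nth i0 s l]%classic.

Lemma cylinder_nil I : cylinder I [::] = setT.
Proof. by apply/seteqP; split. Qed.

Lemma cylinder_rcons I s i : cylinder I (rcons s i) =
  ([set w | I (size s) w = i] `&` cylinder I s)%classic.
Proof.
apply/seteqP; split => w; rewrite /cylinder/= size_rcons.
  move=> H; split => [|l ls]; first by rewrite H// nth_rcons ltnn eqxx.
  by rewrite H ?nth_rcons ?ls// ltnS ltnW.
case=> Hi H l; rewrite ltnS leq_eqVlt nth_rcons => /orP[/eqP->|ls].
  by rewrite ltnn eqxx.
by rewrite ls H.
Qed.

Lemma mkseq_cylinder {I s w} : cylinder I s w ->
  mkseq (fun l => I l w) (size s) = s.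
Proof.
move=> ws; apply: (@eq_from_nth _ i0); rewrite size_mkseq// => l ls.
by rewrite nth_mkseq// ws.
Qed.

Lemma measurable_cylinder {I} :
  (forall k i, measurable [set w | I k w = i]%classic) ->
  forall s, measurable (cylinder I s).
Proof.
move=> mI; elim/last_ind => [|s i IH]; first by rewrite cylinder_nil.
by rewrite cylinder_rcons; apply: measurableI.
Qed.

Lemma cylinder_split I s :
  cylinder I s = (\big[setU/set0]_(i : 'I_d) cylinder I (rcons s i))%classic.
Proof.
rewrite -bigcup_seq; apply/seteqP; split => w.
  move=> ws; exists (I (size s) w); first by rewrite /= mem_index_enum.
  by rewrite cylinder_rcons.
by case=> i _; rewrite cylinder_rcons => -[].
Qed.

Lemma probability_cylinder_rcons {L alpha I} : random_coordinates P L alpha I ->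
  forall s i, P (cylinder I (rcons s i)) =
    ((coordinate_law L alpha i)%:E * P (cylinder I s))%E.
Proof.
move=> [_ PI PIind] s i.
by rewrite cylinder_rcons -(PI (size s)); exact: PIind.
Qed.

(** Induction on the number of remaining draws, splitting the cylinder of [s]
    into those of [rcons s i]; independence of the past gives the ratio of
    their probabilities.  Measurability of the integrand is proved along the
    same splitting, since it is needed for the additivity of the integral. *)
Lemma integral_cylinder {L alpha I} : random_coordinates P L alpha I ->
  forall g m s,
  let Y w := g (mkseq (fun l => I l w) (size s + m)) in
  measurable_fun (cylinder I s) Y /\
  (\int[P]_(w in cylinder I s) (Y w)%:E =
   (forecast (coordinate_law L alpha) g m s)%:E * P (cylinder I s))%E.
Proof.
move=> hI g; have [mI _ _] := hI; have mC := measurable_cylinder mI.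
elim=> [|m IH] s Y.
  have Ycst : {in cylinder I s, cst (g s) =1 Y}.
    by move=> w /set_mem ws; rewrite /Y addn0 mkseq_cylinder.
  split; first by apply: eq_measurable_fun Ycst _; exact: measurable_cst.
  rewrite -integral_cst//; apply: eq_integral => w /Ycst/= <-//.
have {}IH i : measurable_fun (cylinder I (rcons s i)) Y /\
    (\int[P]_(w in cylinder I (rcons s i)) (Y w)%:E =
     (forecast (coordinate_law L alpha) g m (rcons s i))%:E
       * P (cylinder I (rcons s i)))%E.
  by have := IH (rcons s i); rewrite size_rcons addSnnS.
have mY : measurable_fun (cylinder I s) Y.
  rewrite cylinder_split.
  set U := (\big[setU/set0]_i _)%classic.
  suff: measurable U /\ measurable_fun U Y by case.
  apply: (big_ind (fun A => measurable A /\ measurable_fun A Y)).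
  - split=> //; exact: measurable_fun_set0.
  - move=> A B [mA AY] [mB BY]; split; first exact: measurableU.
    exact/measurable_funU.
  - by move=> i _; split; [exact: mC|case: (IH i)].
split=> //.
rewrite {1}cylinder_split integral_bigsetU_EFin//=.
- under eq_bigr do rewrite (IH _).2 (probability_cylinder_rcons hI) muleA.
  have /fineK <- : P (cylinder I s) \is a fin_num by exact: fin_num_measure.
  rewrite -EFinM mulr_suml -sumEFin; apply: eq_bigr => i _.
  by rewrite -!EFinM; congr (_%:E); ring.
- exact: index_enum_uniq.
- move=> i j _ _ [w []]; rewrite !cylinder_rcons => -[/= <- _] [<-]//.
- by rewrite -cylinder_split; exact/measurable_EFinP.
Qed.
End RandomCoordinates.

(** * The iterates as functions of the history *)

Section Run.
Context {R : realType} {d : nat} (i0 : 'I_d).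
Implicit Types (f : 'rV[R]_d -> R).

(** The default [i0] of [nth] is never read: a run of [size s] iterations
    queries only the first [size s] coordinates. *)
Definition iterate (phi : oracle R d) (search : line_search R d)
    (x0 : 'rV[R]_d) (s : seq 'I_d) : 'rV[R]_d :=
  OrderRCD phi search x0 (nth i0 s) (size s).

Lemma OrderRCD_mkseq phi search x0 (i_ : nat -> 'I_d) k :
  OrderRCD phi search x0 i_ k = iterate phi search x0 (mkseq i_ k).
Proof.
rewrite /iterate size_mkseq.
have E n : (n <= k)%N -> OrderRCD phi search x0 i_ n =
    OrderRCD phi search x0 (nth i0 (mkseq i_ k)) n; last exact: E.
elim: n => //= n IH nk; rewrite -IH 1?ltnW// nth_mkseq//.
congr (_ + search _ _ _ _ *: _).
apply: (@eq_from_nth _ i0); rewrite !size_mkseq// => l ln.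
by rewrite !nth_mkseq// (ltn_trans ln).
Qed.

Context {disp : measure_display} {T : measurableType disp}.
Context {P : probability T R}.

(** The guarantee of the line search speaks of actual runs.  An extension of a
    history of positive probability has positive probability again, so its
    cylinder is nonempty and any of its outcomes provides the guarantee. *)
Lemma iterate_rcons_le {L alpha I} :
  (forall i, 0 < L i) -> random_coordinates P L alpha I ->
  forall f phi search x0 eps c Delta,
  (forall w, line_search_guarantee f phi search x0 eps c Delta (I ^~ w)) ->
  forall s, (0 < P (cylinder i0 I s))%E -> forall i eta,
  (0 < P (cylinder i0 I (rcons s i)))%E /\
  f (iterate phi search x0 (rcons s i)) <=
    f (iterate phi search x0 s + eta *: unit_vec R i)
      + (eps + c * golden_ratio R * Delta).
Proof.
move=> L0 hI f phi search x0 eps c Delta fmin s Ps i eta.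
have Psi : (0 < P (cylinder i0 I (rcons s i)))%E.
  rewrite (probability_cylinder_rcons i0 P hI) mule_gt0// lte_fin.
  by rewrite divr_gt0 ?powR_gt0// sum_weights_gt0.
split=> //.
have [w wsi] : (cylinder i0 I (rcons s i) !=set0)%classic.
  by apply/set0P; apply: contraTneq Psi => ->; rewrite measure0 ltxx.
move: (wsi); rewrite cylinder_rcons => -[/= wi ws].
have := fmin w (size s) eta; rewrite /= addrA wi.
have <- : OrderRCD phi search x0 (I ^~ w) (size s) = iterate phi search x0 s.
  by rewrite OrderRCD_mkseq (mkseq_cylinder i0 ws).
have <- : OrderRCD phi search x0 (I ^~ w) (size s).+1
    = iterate phi search x0 (rcons s i).
  by rewrite OrderRCD_mkseq -(size_rcons s i) (mkseq_cylinder i0 wsi).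
by rewrite /OrderRCD_step/= wi.
Qed.

(** The expected gap contracts at each draw.  The induction is on the future
    draws, so that the single-step decrease is applied at the fixed point reached
    by the history [s]; positivity of its probability is carried along to
    make the line-search guarantee available. *)
Lemma forecast_gap_le {L alpha I mu f} :
  (forall i, 0 < L i) -> random_coordinates P L alpha I ->
  0 < mu -> (forall x, differentiable f x) -> coordinate_lipschitz L f ->
  strongly_convex L (1 - alpha) mu f ->
  forall phi search x0 eps c Delta,
  (forall w, line_search_guarantee f phi search x0 eps c Delta (I ^~ w)) ->
  forall xstar m s, (0 < P (cylinder i0 I s))%E ->
  forecast (coordinate_law L alpha) (f \o iterate phi search x0) m s - f xstar
  <= (1 - mu / S_ L alpha) ^+ m * (f (iterate phi search x0 s) - f xstar)
     + (eps + c * golden_ratio R * Delta)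
         * \sum_(j < m) (1 - mu / S_ L alpha) ^+ j.
Proof.
move=> L0 hI mu0 fD fL fC phi search x0 eps c Delta fmin xstar.
have S0 := sum_weights_gt0 i0 L0 alpha.
set q := 1 - mu / S_ L alpha; set A := eps + _.
have q0 : 0 <= q.
  rewrite subr_ge0 ler_pdivrMr// mul1r.
  exact: strong_convexity_le_weights i0 L0 fL fC.
elim=> [|m IH] s Ps /=; first by rewrite big_ord0 mulr0 addr0 expr0 mul1r.
have step i := iterate_rcons_le L0 hI f phi search x0 eps c Delta fmin s Ps i.
pose p := coordinate_law L alpha.
pose gap t := f (iterate phi search x0 t) - f xstar.
have p0 i : 0 <= p i by rewrite divr_ge0 ?powR_ge0// ltW.
have p1 : \sum_i p i = 1 := coordinate_law_sum1 i0 L0 alpha.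
have avg : \sum_i p i * gap (rcons s i) <= q * gap s + A.
  by apply: average_decrease => // i eta; exact: (step i eta).2.
apply: (@le_trans _ _ (\sum_i p i * (q ^+ m * gap (rcons s i)
    + A * \sum_(j < m) q ^+ j))).
  rewrite -[X in _ - X]mul1r -p1 mulr_suml -sumrB; apply: ler_sum => i _.
  by rewrite -mulrBr; apply: ler_wpM2l => //; exact: IH (step i 0).1.
rewrite (eq_bigr (fun i => q ^+ m * (p i * gap (rcons s i))
    + p i * (A * \sum_(j < m) q ^+ j))); last by move=> i _; ring.
rewrite big_split/= -mulr_sumr -mulr_suml p1 mul1r big_ord_recr/= exprSr.
by have := ler_wpM2l (exprn_ge0 m q0) avg; rewrite -/(gap s); lra.
Qed.
End Run.

(** * Convergence rate *)

Theorem theorem3p3 (R : realType) (d : nat) (alpha : R) (halpha : 0 <= alpha)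
  (L : 'I_d -> R) (hL : forall i, 0 < L i)
  (f : 'rV[R]_d -> R) (hdiff : forall x, differentiable f x)
  (hlip : coordinate_lipschitz L f)
  (mu : R) (hmu : 0 < mu) (hconv : strongly_convex L (1 - alpha) mu f)
  (xstar : 'rV[R]_d) (hmin : minimizer f xstar)
  (Delta : R) (hDelta : 0 <= Delta)
  (delta : 'rV[R]_d -> 'rV[R]_d -> R)
  (hdelta : forall x y, `|delta x y| <= Delta)
  (eps : R) (heps : 0 <= eps) (c : R) (hc : 0 <= c)
  (search : line_search R d) (x0 : 'rV[R]_d)
  (disp : measure_display) (T : measurableType disp) (P : probability T R)
  (I : nat -> T -> 'I_d) (hI : random_coordinates P L alpha I)
  (hsearch : forall w : T,
     line_search_guarantee f (order_oracle f delta) search x0 eps c Delta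
       (fun k => I k w))
  (N : nat) :
  let x_ := fun (k : nat) (w : T) =>
    OrderRCD (order_oracle f delta) search x0 (fun l => I l w) k in
  let F0 := f x0 - f xstar in
  let Phi := golden_ratio R in
  ('E_P[fun w => f (x_ N w)] - (f xstar)%:E <=
    ((1 - mu / S_ L alpha) ^+ N * F0
     + 2 * S_ L alpha * eps / mu
     + 2 * c * S_ L alpha * Phi * Delta / mu)%:E)%E.
Proof.
cbv zeta; set F0 := f x0 - f xstar; set Phi := golden_ratio R.
(* A probability space has an outcome, so the index set is nonempty. *)
have i0 : 'I_d := I 0%N point.
have S0 := sum_weights_gt0 i0 hL alpha.
have q1 := strong_convexity_le_weights i0 hL hlip hconv.
set phi := order_oracle f delta; set q := mu / S_ L alpha.
have [q0 qle1] : 0 < q /\ q <= 1 by rewrite divr_gt0// ler_pdivrMr ?mul1r.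
set A := eps + c * Phi * Delta.
have A0 : 0 <= A.
  by rewrite addr_ge0// !mulr_ge0// divr_ge0// addr_ge0// sqrtr_ge0.
have -> : ('E_P[fun w => f (OrderRCD phi search x0 (I ^~ w) N)] =
    (forecast (coordinate_law L alpha) (f \o iterate i0 phi search x0) N [::])%:E)%E.
  have [_] := integral_cylinder i0 P hI (f \o iterate i0 phi search x0) N [::].
  rewrite cylinder_nil probability_setT mule1 add0n unlock => <-.
  by apply: eq_integral => w _; rewrite (OrderRCD_mkseq i0).
rewrite -EFinB lee_fin.
have Pnil : (0 < P (cylinder i0 I [::]))%E.
  by rewrite cylinder_nil probability_setT lte01.
apply: le_trans (forecast_gap_le i0 hL hI hmu hdiff hlip hconv phi search x0
  eps c Delta hsearch xstar N [::] Pnil) _; rewrite -/q -/Phi -/A.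
have -> : (1 - q) ^+ N * F0 + 2 * S_ L alpha * eps / mu
    + 2 * c * S_ L alpha * Phi * Delta / mu = (1 - q) ^+ N * F0 + 2 * (A / q).
  by rewrite /A /q; field; rewrite ?gt_eqF.
rewrite lerD2l.
have geom : q * (\sum_(j < N) (1 - q) ^+ j) <= 1.
  have := subrX1 (1 - q) N; have : 0 <= (1 - q) ^+ N by rewrite exprn_ge0// subr_ge0.
  by move=> ? E; lra.
have Aq0 : 0 <= A / q by rewrite divr_ge0// ltW.
apply: (@le_trans _ _ (A / q)); last by lra.
by apply: ler_wpM2l => //; rewrite -div1r ler_pdivlMr// mulrC.
Qed.
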